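(* Let $n,m,k$ be positive integers, let $X\in\mathbb{C}^{n\times n}$ be Hermitian, let $\Lambda:\mathbb{C}^{n\times n}\to\mathbb{C}^{m\times m}$ be a Hermitian-preserving linear map and $Y\in\mathbb{C}^{m\times m}$ Hermitian. Let $\xi$ be the optimal value of \[ \max_{\rho\in\mathbb{C}^{n\times n}}\ \operatorname{Tr}(X\rho)\quad\text{s.t.}\quad \Lambda(\rho)\le Y,\ \operatorname{Tr}(\rho)=1,\ \rho\ge 0,\ \operatorname{rank}(\rho)\le k . \] For a positive integer $N$, let $\mathcal{H}_A=\cdots=\mathcal{H}_Z=\mathbb{C}^n\otimes\mathbb{C}^k$ be $N$ copies (parties $A,\dots,Z$), $\widetilde{X}=X\otimes\mathbb{1}_k$, $\widetilde{\Lambda}(\cdot)=\Lambda[\operatorname{Tr}_2(\cdot)]$ with $\operatorname{Tr}_2$ the partial trace over $\mathbb{C}^k$, and let $\xi_N$ be the optimal value of the semidefinite program \[ \max_{\Phi_{AB\cdots Z}}\ \operatorname{Tr}\big[(\widetilde{X}_A\otimes\mathbb{1}_{B\cdots Z})\Phi_{AB\cdots Z}\big]\ \text{s.t.}\ \Phi_{AB\cdots Z}\ge0,\ \operatorname{Tr}(\Phi_{AB\cdots Z})=1,\ P_N^+\Phi_{AB\cdots Z}P_N^+=\Phi_{AB\cdots Z}, \] \[ (\widetilde{\Lambda}_A\otimes\mathrm{id}_{B\cdots Z})(\Phi_{AB\cdots Z})\le Y\otimes\operatorname{Tr}_A(\Phi_{AB\cdots Z}). \] Then $\xi\le\xi_N$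 for every $N$, $\xi_{N+1}\le\xi_N$ for all $N$, and $\lim_{N\to+\infty}\xi_N=\xi$.
   Context: $\le$ between Hermitian matrices is the Löwner order ($A\le B$ iff $B-A$ is positive semidefinite). A map is Hermitian-preserving if it maps Hermitian matrices to Hermitian matrices. $P_N^+=\frac{1}{N!}\sum_{\sigma\in S_N}V_\sigma$ is the orthogonal projector onto the symmetric subspace of $(\mathbb{C}^n\otimes\mathbb{C}^k)^{\otimes N}$, with $V_\sigma$ permuting the $N$ tensor factors. A subscript $A$ indicates action on the first party, $\mathrm{id}_{B\cdots Z}$ is the identity map on the remaining parties, and $\operatorname{Tr}_A$ is the partial trace over the first party. *)

(* Defs.v *)
From HB Require Import structures.
From mathcomp Require Import all_boot all_order all_fingroup all_algebra.
From mathcomp Require Import all_classical all_reals all_analysis.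
From mathcomp.real_closed Require Import complex.

Set Implicit Arguments.
Unset Strict Implicit.
Unset Printing Implicit Defensive.

Import Order.TTheory GRing.Theory Num.Theory.
Local Open Scope ring_scope.

Section Defs.
Variable R : realType.
Local Notation C := (R[i]).

(* ---- operators on C^T, T a finite index type, as kernels T -> T -> C ---- *)
Definition opmul (T : finType) (A B : T -> T -> C) : T -> T -> C :=
  fun i j => \sum_(l : T) A i l * B l j.
Definition optr (T : finType) (A : T -> T -> C) : C := \sum_(i : T) A i i.
Definition oppsd (T : finType) (A : T -> T -> C) : Prop :=
  forall u : T -> C, 0 <= \sum_(i : T) \sum_(j : T) (u i)^* * A i j * u j.
Definition ople (T : finType) (A B : T -> T -> C) : Prop :=
  oppsd (fun i j => B i j - A i j).

Definition hermmx (p : nat) (A : 'M[C]_p) : Prop :=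
  forall i j, A j i = (A i j)^*.
Definition psdmx (p : nat) (A : 'M[C]_p) : Prop := oppsd (fun i j => A i j).
Definition mxle (p : nat) (A B : 'M[C]_p) : Prop :=
  ople (fun i j => A i j) (fun i j => B i j).
Definition herm_preserving (p q : nat) (L : 'M[C]_p -> 'M[C]_q) : Prop :=
  forall A, hermmx A -> hermmx (L A).

Definition xi_val (n m k : nat) (X : 'M[C]_n) (L : 'M[C]_n -> 'M[C]_m)
  (Y : 'M[C]_m) : \bar R :=
  ereal_sup [set x : \bar R | exists rho : 'M[C]_n,
     [/\ mxle (L rho) Y, \tr rho = 1, psdmx rho, (\rank rho <= k)%N
       & x = (complex.Re (\tr (X *m rho)))%:E]].

(* ---- N-party space (C^n (x) C^k)^{(x) N}: basis indexed by functions
        'I_N -> 'I_n * 'I_k (party i is index i; party A is ord0) ---- *)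
Definition pcons (n k N : nat) (x : 'I_n * 'I_k) (s : {ffun 'I_N -> 'I_n * 'I_k})
  : {ffun 'I_N.+1 -> 'I_n * 'I_k} :=
  [ffun i : 'I_N.+1 => if unlift ord0 i is Some j then s j else x].
Definition ptl (n k N : nat) (f : {ffun 'I_N.+1 -> 'I_n * 'I_k})
  : {ffun 'I_N -> 'I_n * 'I_k} := [ffun j => f (lift ord0 j)].

Definition symproj (D : finType) (N : nat) : {ffun 'I_N -> D} -> {ffun 'I_N -> D} -> C :=
  fun f g => (N`!%:R)^-1 * \sum_(s : 'S_N) (f == [ffun i => g (s i)])%:R.

Definition XtA (n k N : nat) (X : 'M[C]_n)
  (f g : {ffun 'I_N.+1 -> 'I_n * 'I_k}) : C :=
  X (f ord0).1 (g ord0).1 * ((f ord0).2 == (g ord0).2)%:R * (ptl f == ptl g)%:R.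

(* (Lambda~_A (x) id_{B..Z})(Phi), Lambda~ = Lambda o Tr_2 ; lives on C^m (x) rest *)
Definition LamA (n m k N : nat) (L : 'M[C]_n -> 'M[C]_m)
  (Phi : {ffun 'I_N.+1 -> 'I_n * 'I_k} -> {ffun 'I_N.+1 -> 'I_n * 'I_k} -> C)
  (a b : 'I_m * {ffun 'I_N -> 'I_n * 'I_k}) : C :=
  L (\matrix_(i, j) \sum_(l : 'I_k) Phi (pcons (i, l) a.2) (pcons (j, l) b.2)) a.1 b.1.

Definition YtrA (n m k N : nat) (Y : 'M[C]_m)
  (Phi : {ffun 'I_N.+1 -> 'I_n * 'I_k} -> {ffun 'I_N.+1 -> 'I_n * 'I_k} -> C)
  (a b : 'I_m * {ffun 'I_N -> 'I_n * 'I_k}) : C :=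
  Y a.1 b.1 * \sum_(x : 'I_n * 'I_k) Phi (pcons x a.2) (pcons x b.2).

Definition sdp_val (n m k : nat) (X : 'M[C]_n) (L : 'M[C]_n -> 'M[C]_m)
  (Y : 'M[C]_m) (N' : nat) : \bar R :=
  ereal_sup [set x : \bar R | exists
     Phi : {ffun 'I_N'.+1 -> 'I_n * 'I_k} -> {ffun 'I_N'.+1 -> 'I_n * 'I_k} -> C,
     [/\ oppsd Phi, optr Phi = 1,
         opmul (opmul (@symproj ('I_n * 'I_k)%type N'.+1) Phi)
               (@symproj ('I_n * 'I_k)%type N'.+1) = Phi,
         ople (LamA L Phi) (YtrA Y Phi)
       & x = (complex.Re (optr (opmul (XtA X) Phi)))%:E]].

(* xi_N for N >= 1 parties (xi_N := sdp_val ... (N-1)) *)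
Definition xiN (n m k : nat) (X : 'M[C]_n) (L : 'M[C]_n -> 'M[C]_m)
  (Y : 'M[C]_m) (N : nat) : \bar R := @sdp_val n m k X L Y N.-1.

End Defs.

(* Main.v *)
Require Import Defs.
From HB Require Import structures.
From mathcomp Require Import all_boot all_order all_fingroup all_algebra.
From mathcomp Require Import all_classical all_reals all_analysis.
From mathcomp.real_closed Require Import complex.
From mathcomp Require Import ring lra.
Import Order.TTheory GRing.Theory Num.Theory numFieldNormedType.Exports.
Local Open Scope ring_scope.

Set Implicit Arguments.
Unset Strict Implicit.
Unset Printing Implicit Defensive.

(** The lower bound [xi <= xi_N] uses [(|psi><psi|)^{(x) N}] with [psi] a
    purification of [rho], which fits in [C^n (x) C^k] because [rank rho <= k].
    Tracing out one party gives monotonicity.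

    For the limit, call an operator feasible if it is positive, symmetric and
    satisfies the [Lambda]-constraint, without normalisation.  Projecting one
    party onto a vector sends feasible operators on [N + 1] parties to feasible
    operators on [N] parties.  Perturb the objective to the strictly convex
    energy [Tr (X rho) + e ||rho||^2] of the one-party marginal [rho], and let
    [G] be the limit of its suprema over [N] parties.  If the energy of a state
    on [N + 1] parties is near [G], and no energy on [N] parties exceeds [G] by
    much, then projecting one party onto the vectors of a resolution of the
    identity barely changes the marginal of another party, for otherwise strict
    convexity would make the average energy too large.  Hence the two-party
    marginal is close to [rho (x) rho]; since it is also invariant under
    permuting the row indices alone, [rho] is nearly of rank one.  A limit point
    is of rank one and feasible, and its objective is at least [lim xi_N].  *)

(** * Positive operators *)

Section ComplexParts.
Variable R : realType.
Local Notation C := (R[i]).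
Local Notation cRe := (@complex.Re R).
Local Notation cIm := (@complex.Im R).

Lemma ReD (z w : C) : cRe (z + w) = cRe z + cRe w.
Proof. by case: z; case: w. Qed.
Lemma ImD (z w : C) : cIm (z + w) = cIm z + cIm w.
Proof. by case: z; case: w. Qed.
Lemma ReN (z : C) : cRe (- z) = - cRe z.
Proof. by case: z. Qed.
Lemma ImN (z : C) : cIm (- z) = - cIm z.
Proof. by case: z. Qed.
Lemma ReM (z w : C) : cRe (z * w) = cRe z * cRe w - cIm z * cIm w.
Proof. by case: z; case: w. Qed.
Lemma ImM (z w : C) : cIm (z * w) = cRe z * cIm w + cIm z * cRe w.
Proof. by case: z; case: w. Qed.
Lemma ReC (z : C) : cRe (z^*) = cRe z.
Proof. by case: z. Qed.
Lemma ImC (z : C) : cIm (z^*) = - cIm z.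
Proof. by case: z. Qed.
Lemma Re_sum (I : finType) (F : I -> C) :
  cRe (\sum_i F i) = \sum_i cRe (F i).
Proof. exact: (big_morph _ ReD). Qed.
Lemma Im_sum (I : finType) (F : I -> C) :
  cIm (\sum_i F i) = \sum_i cIm (F i).
Proof. exact: (big_morph _ ImD). Qed.
Lemma complex_ext (z w : C) : cRe z = cRe w -> cIm z = cIm w -> z = w.
Proof. by case: z => a b; case: w => c d /= -> ->. Qed.
Lemma ge0_complexP (z : C) : (0 <= z) <-> (cIm z = 0 /\ 0 <= cRe z).
Proof. by rewrite lecE /=; split=> [/andP[/eqP-> ->]|[-> ->]] //; rewrite eqxx. Qed.

End ComplexParts.


Section Psd.
Variable R : realType.
Local Notation C := (R[i]).
Local Notation cRe := (@complex.Re R).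
Local Notation cIm := (@complex.Im R).

Lemma sum_delta (T : finType) (x : T) (F : T -> C) :
  \sum_(i : T) (i == x)%:R * F i = F x.
Proof.
rewrite (bigD1 x) //= eqxx mul1r big1 ?addr0 // => i /negPf ->.
by rewrite mul0r.
Qed.

Lemma sum_pair (I J : finType) (F : I * J -> C) :
  \sum_x F x = \sum_i \sum_j F (i, j).
Proof. by rewrite pair_bigA; apply: eq_bigr => -[]. Qed.

Lemma eq_oppsd (T : finType) (A B : T -> T -> C) :
  (forall i j, A i j = B i j) -> oppsd A -> oppsd B.
Proof.
move=> AB psdA u; under eq_bigr do under eq_bigr do rewrite -AB.
exact: psdA.
Qed.

(** A vector [u] on [I] pushes forward to its sums over the fibres of [phi], and the two quadratic
    forms agree. Since [phi] may repeat indices, test vectors can live on auxiliary types such as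
    [bool] or [T + unit]. *)
Lemma oppsd_pullback (I T : finType) (phi : I -> T) (A : T -> T -> C) :
  oppsd A -> oppsd (fun i j => A (phi i) (phi j)).
Proof.
move=> psdA u.
pose w t := \sum_(i | phi i == t) u i.
suff -> : \sum_i \sum_j (u i)^* * A (phi i) (phi j) * u j =
          \sum_s \sum_t (w s)^* * A s t * w t by exact: psdA.
rewrite (partition_big phi predT) //=; apply: eq_bigr => s _.
rewrite exchange_big (partition_big phi predT) //=; apply: eq_bigr => t _.
rewrite /w rmorph_sum mulr_suml mulr_suml exchange_big /=.
apply: eq_bigr => i /eqP <-; rewrite mulr_sumr.
by apply: eq_bigr => j /eqP <-.
Qed.

(** Compression of [B] by [v] on the first factor: its form at [u] is the form of [B] at the product
    vector of [v] and [u]. *)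
Lemma oppsd_contract (P S : finType) (v : P -> C)
    (B : P * S -> P * S -> C) : oppsd B ->
  oppsd (fun s t => \sum_p \sum_q (v p)^* * v q * B (p, s) (q, t)).
Proof.
move=> psdB u.
suff -> : \sum_s \sum_t
    (u s)^* * (\sum_p \sum_q (v p)^* * v q * B (p, s) (q, t)) * u t =
  \sum_x \sum_y (v x.1 * u x.2)^* * B x y * (v y.1 * u y.2) by exact: psdB.
transitivity (\sum_p \sum_s \sum_q \sum_t
   (v p * u s)^* * B (p, s) (q, t) * (v q * u t)); last first.
  rewrite pair_bigA; apply: eq_bigr => -[p s] _ /=; rewrite pair_bigA.
  by apply: eq_bigr => -[q t] _.
rewrite [RHS]exchange_big /=; apply: eq_bigr => s _.
under eq_bigr do rewrite mulr_sumr mulr_suml.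
rewrite exchange_big /=; apply: eq_bigr => p _.
under eq_bigr do rewrite mulr_sumr mulr_suml.
rewrite exchange_big /=; apply: eq_bigr => q _; apply: eq_bigr => t _.
by rewrite rmorphM; ring.
Qed.

Lemma oppsd_lincomb (T J : finType) (c : J -> C) (A : J -> T -> T -> C) :
  (forall j, 0 <= c j) -> (forall j, oppsd (A j)) ->
  oppsd (fun s t => \sum_j c j * A j s t).
Proof.
move=> c0 psdA u.
suff -> : \sum_s \sum_t (u s)^* * (\sum_j c j * A j s t) * u t =
  \sum_j c j * \sum_s \sum_t (u s)^* * A j s t * u t.
  by apply: sumr_ge0 => j _; apply: mulr_ge0 (c0 j) (psdA j u).
under eq_bigr do under eq_bigr do rewrite mulr_sumr mulr_suml.
under eq_bigr do rewrite exchange_big /=.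
rewrite exchange_big /=; apply: eq_bigr => j _; rewrite mulr_sumr.
apply: eq_bigr => s _; rewrite mulr_sumr; apply: eq_bigr => t _.
by ring.
Qed.

Lemma oppsd_sum (T J : finType) (A : J -> T -> T -> C) :
  (forall j, oppsd (A j)) -> oppsd (fun s t => \sum_j A j s t).
Proof.
move=> psdA; apply: (@eq_oppsd _ (fun s t => \sum_j 1 * A j s t)).
  by move=> s t; apply: eq_bigr => j _; rewrite mul1r.
exact: oppsd_lincomb.
Qed.

Lemma oppsd_qf2 (T : finType) (A : T -> T -> C) (x y : T) (a : C) : oppsd A ->
  0 <= A x x + a * A x y + a^* * A y x + a^* * a * A y y.
Proof.
move=> psdA; pose v (b : bool) : C := if b then 1 else a.
have := oppsd_pullback (fun b : bool => if b then x else y) psdA v.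
rewrite !big_bool /= /v conjC1 !mul1r !mulr1; congr (0 <= _); ring.
Qed.

Lemma oppsd_diag (T : finType) (A : T -> T -> C) (x : T) : oppsd A -> 0 <= A x x.
Proof.
move=> psdA; have := oppsd_qf2 x x 0 psdA.
by rewrite conjC0 !mul0r !addr0.
Qed.

(** The form at [e_x + a e_y] is a nonnegative real for [a = 1, -1, i, -i]. Its vanishing imaginary
    parts give Hermitian symmetry, its signs give the two bounds. *)
Lemma oppsd_entries (T : finType) (A : T -> T -> C) (x y : T) : oppsd A ->
  [/\ A y x = (A x y)^*, `|cRe (A x y)| <= (cRe (A x x) + cRe (A y y)) / 2
    & `|cIm (A x y)| <= (cRe (A x x) + cRe (A y y)) / 2].
Proof.
move=> psdA.
have /ge0_complexP[dx _] := oppsd_diag x psdA.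
have /ge0_complexP[dy _] := oppsd_diag y psdA.
have /ge0_complexP[] := oppsd_qf2 x y 1 psdA.
have /ge0_complexP[] := oppsd_qf2 x y (-1) psdA.
have /ge0_complexP[] := oppsd_qf2 x y (Complex 0 1) psdA.
have /ge0_complexP[] := oppsd_qf2 x y (Complex 0 (-1)) psdA.
rewrite !(ReD, ImD, ReM, ImM, ReC, ImC, ReN, ImN) /= dx dy.
move=> a1 a2 a3 a4 a5 a6 a7 a8.
have e1 : cRe (A y x) = cRe (A x y) by lra.
have e2 : cIm (A y x) = - cIm (A x y) by lra.
split.
- by apply: complex_ext; rewrite ?ReC ?ImC.
- by rewrite ler_norml; apply/andP; split; lra.
- by rewrite ler_norml; apply/andP; split; lra.
Qed.

Lemma oppsd_herm (T : finType) (A : T -> T -> C) (x y : T) :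
  oppsd A -> A y x = (A x y)^*.
Proof. by move/oppsd_entries => /(_ x y)[]. Qed.

Lemma optr_ge0 (T : finType) (A : T -> T -> C) : oppsd A -> 0 <= optr A.
Proof. by move=> psdA; apply: sumr_ge0 => i _; exact: oppsd_diag. Qed.

Lemma oppsd_diag_le (T : finType) (A : T -> T -> C) (x : T) : oppsd A ->
  cRe (A x x) <= cRe (optr A).
Proof.
move=> psdA; rewrite Re_sum (bigD1 x) //= lerDl; apply: sumr_ge0 => i _.
by have /ge0_complexP[] := oppsd_diag i psdA.
Qed.

Lemma oppsd_bound (T : finType) (A : T -> T -> C) (x y : T) : oppsd A ->
  `|cRe (A x y)| <= cRe (optr A) /\ `|cIm (A x y)| <= cRe (optr A).
Proof.
move=> psdA; have [_ h1 h2] := oppsd_entries x y psdA.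
have := oppsd_diag_le x psdA; have := oppsd_diag_le y psdA.
by move=> ? ?; split; [apply: le_trans h1 _|apply: le_trans h2 _]; lra.
Qed.

Lemma oppsd_tr0 (T : finType) (A : T -> T -> C) (x y : T) : oppsd A ->
  optr A = 0 -> A x y = 0.
Proof.
move=> psdA tr0; have [] := oppsd_bound x y psdA; rewrite tr0 /=.
by rewrite !normr_le0 => /eqP h1 /eqP h2; exact: complex_ext.
Qed.

End Psd.

(** * Permutation-invariant operators and marginals *)

Section Parties.
Variable R : realType.
Local Notation C := (R[i]).
Variables n k : nat.
Local Notation D := ('I_n * 'I_k)%type.
Local Notation op N := ({ffun 'I_N -> D} -> {ffun 'I_N -> D} -> C).

Lemma pcons_ord0 N (x : D) (s : {ffun 'I_N -> D}) : pcons x s ord0 = x.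
Proof. by rewrite ffunE unlift_none. Qed.

Lemma pcons_lift N (x : D) (s : {ffun 'I_N -> D}) j :
  pcons x s (lift ord0 j) = s j.
Proof. by rewrite ffunE liftK. Qed.

Lemma ptl_pcons N (x : D) (s : {ffun 'I_N -> D}) : ptl (pcons x s) = s.
Proof. by apply/ffunP => j; rewrite ffunE pcons_lift. Qed.

Lemma pcons_ptl N (f : {ffun 'I_N.+1 -> D}) : pcons (f ord0) (ptl f) = f.
Proof.
by apply/ffunP => i; rewrite ffunE; case: unliftP => [j ->|->] //; rewrite ffunE.
Qed.

Lemma sum_pcons N (F : {ffun 'I_N.+1 -> D} -> C) :
  \sum_f F f = \sum_x \sum_s F (pcons x s).
Proof.
rewrite pair_bigA /=.
rewrite (reindex (fun p : D * {ffun 'I_N -> D} => pcons p.1 p.2)) //=.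
exists (fun f : {ffun 'I_N.+1 -> D} => (f ord0, ptl f)) => [[x s] _|f _] /=.
  by rewrite pcons_ord0 ptl_pcons.
exact: pcons_ptl.
Qed.

(** Row and column indices are permuted independently, which is stronger than invariance under
    conjugation and expresses that [Phi] lives on the symmetric subspace. *)
Definition perm_inv N (Phi : op N) :=
  forall (s : 'S_N) (f g : {ffun 'I_N -> D}),
    Phi [ffun i => f (s i)] g = Phi f g /\ Phi f [ffun i => g (s i)] = Phi f g.

Lemma symproj_perml N (s : 'S_N) (f g : {ffun 'I_N -> D}) :
  symproj R [ffun i => f (s i)] g = symproj R f g.
Proof.
rewrite /symproj; congr (_ * _).
rewrite (reindex_inj (mulgI s)) /=; apply: eq_bigr => t _; congr (nat_of_bool _)%:R.
apply/eqP/eqP => [/ffunP e|->].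
  apply/ffunP => i; have := e ((s^-1)%g i).
  by rewrite !ffunE permM permKV.
by apply/ffunP => i; rewrite !ffunE permM.
Qed.

Lemma symproj_permr N (s : 'S_N) (f g : {ffun 'I_N -> D}) :
  symproj R f [ffun i => g (s i)] = symproj R f g.
Proof.
rewrite /symproj; congr (_ * _).
rewrite [RHS](reindex_inj (mulIg s)) /=; apply: eq_bigr => t _; congr (nat_of_bool _)%:R.
congr (_ == _); apply/ffunP => i; by rewrite !ffunE permM.
Qed.

(** The projector absorbs any permutation on either side. Conversely, if [Phi] is invariant, each
    term of the average over permutations reproduces [Phi]. *)
Lemma perm_inv_symproj N (Phi : op N) :
  opmul (opmul (@symproj R D N) Phi) (@symproj R D N) = Phi <-> perm_inv Phi.
Proof.
split=> [<- s f g|inv].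
  split; rewrite /opmul.
    by apply: eq_bigr => l _; under eq_bigr do rewrite symproj_perml.
  by apply: eq_bigr => l _; rewrite symproj_permr.
have fact0 : (N`!%:R : C) != 0 by rewrite pnatr_eq0 -lt0n fact_gt0.
have invl (s : 'S_N) f g :
    \sum_(l : {ffun 'I_N -> D}) (f == [ffun i => l (s i)])%:R * Phi l g = Phi f g.
  pose l0 := [ffun i => f ((s^-1)%g i)].
  rewrite -[RHS](proj1 (inv (s^-1)%g f g)) -/l0 -[RHS](sum_delta l0 (fun l => Phi l g)).
  apply: eq_bigr => l _; congr ((nat_of_bool _)%:R * _); apply/eqP/eqP => [e|->].
    by apply/ffunP => i; rewrite /l0 e !ffunE permKV.
  by apply/ffunP => i; rewrite !ffunE permK.
have invr (s : 'S_N) f (g : {ffun 'I_N -> D}) :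
    \sum_l (l == [ffun i => g (s i)])%:R * Phi f l = Phi f g.
  by rewrite sum_delta (proj2 (inv s f g)).
have avg (F : 'S_N -> C) (x : C) :
    (forall s : 'S_N, F s = x) -> (N`!%:R : C)^-1 * \sum_(s : 'S_N) F s = x.
  move=> Fx; rewrite (eq_bigr (fun _ => x)) // sumr_const.
  by rewrite card_Sn -[x *+ _]mulr_natl mulKf.
apply/funext => f; apply/funext => g; rewrite /opmul.
transitivity (\sum_l Phi f l * symproj R l g).
  apply: eq_bigr => l _; congr (_ * _); rewrite /symproj.
  under eq_bigr do rewrite -mulrA mulr_suml.
  rewrite -mulr_sumr exchange_big /=; apply: avg => s; exact: invl.
rewrite /symproj.
under eq_bigr do rewrite mulrCA mulr_sumr.
rewrite -mulr_sumr exchange_big /=; apply: avg => s.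
by under eq_bigr do rewrite mulrC; exact: invr.
Qed.

Definition slice N (Phi : op N.+1) (p q : D)
  : op N :=
  fun f g => Phi (pcons p f) (pcons q g).

(* The unnormalised state of the other parties after party A is projected onto [v]. *)
Definition cond N (v : D -> C) (Phi : op N.+1)
  : op N :=
  fun f g => \sum_p \sum_q (v p)^* * v q * slice Phi p q f g.

(** The reduced state of party A, obtained by tracing out all the others. *)
Definition marg N (Phi : op N.+1) (p q : D) : C :=
  optr (slice Phi p q).

Lemma pcons_perm N (s : 'S_N) p (f : {ffun 'I_N -> D}) :
  pcons p [ffun i => f (s i)] = [ffun i => pcons p f (lift_perm ord0 ord0 s i)].
Proof.
apply/ffunP => i; rewrite [RHS]ffunE.
case: (unliftP ord0 i) => [j ->|->].
  by rewrite lift_perm_lift !pcons_lift ffunE.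
by rewrite lift_perm_id !pcons_ord0.
Qed.

Lemma perm_inv_slice N (Phi : op N.+1) p q : perm_inv Phi -> perm_inv (slice Phi p q).
Proof.
by move=> inv s f g; rewrite /slice !pcons_perm; exact: inv.
Qed.

(** Exchanging the first two parties is a transposition, so permutation invariance applies to it. *)
Lemma pcons_swap N x y (s : {ffun 'I_N -> D}) :
  pcons x (pcons y s) =
  [ffun i => pcons y (pcons x s) (tperm ord0 (lift ord0 ord0) i)].
Proof.
apply/ffunP => i; rewrite [RHS]ffunE.
case: tpermP => [->|->|/eqP i0 /eqP i1].
- by rewrite pcons_ord0 pcons_lift pcons_ord0.
- by rewrite pcons_ord0 pcons_lift pcons_ord0.
case: (unliftP ord0 i) => [j ij|ij]; last by rewrite ij eqxx in i0.
rewrite ij in i1 *; rewrite !pcons_lift.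
case: (unliftP ord0 j) => [l jl|jl]; last by rewrite jl eqxx in i1.
by rewrite jl !pcons_lift.
Qed.

Lemma perm_inv_swapl N (Phi : op N.+2) : perm_inv Phi -> forall x y s g,
  Phi (pcons x (pcons y s)) g = Phi (pcons y (pcons x s)) g.
Proof. by move=> inv x y s g; rewrite pcons_swap; exact: (inv _ _ _).1. Qed.

Lemma perm_inv_swapr N (Phi : op N.+2) : perm_inv Phi -> forall x y s g,
  Phi g (pcons x (pcons y s)) = Phi g (pcons y (pcons x s)).
Proof. by move=> inv x y s g; rewrite pcons_swap; exact: (inv _ _ _).2. Qed.

Lemma optrE N (Phi : op N.+1) : optr Phi = optr (marg Phi).
Proof. by rewrite /optr sum_pcons. Qed.

Lemma oppsd_marg N (Phi : op N.+1) : oppsd Phi -> oppsd (marg Phi).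
Proof.
move=> psd; apply: oppsd_sum => s.
exact: (oppsd_pullback (fun p => pcons p s)).
Qed.

Lemma oppsd_cond N v (Phi : op N.+1) : oppsd Phi -> oppsd (cond v Phi).
Proof.
move=> psd; have := oppsd_pullback (fun p => pcons p.1 p.2) psd.
exact: oppsd_contract.
Qed.

Lemma optr_cond N v (Phi : op N.+1) :
  optr (cond v Phi) = \sum_p \sum_q (v p)^* * v q * marg Phi p q.
Proof.
rewrite /optr /cond exchange_big /=; apply: eq_bigr => p _.
rewrite exchange_big /=; apply: eq_bigr => q _.
by rewrite -mulr_sumr.
Qed.

Lemma marg_cond N v (Phi : op N.+2) x y : marg (cond v Phi) x y =
  \sum_p \sum_q (v p)^* * v q * marg (slice Phi p q) x y.
Proof.
rewrite /marg /optr /slice /cond exchange_big /=; apply: eq_bigr => p _.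
rewrite exchange_big /=; apply: eq_bigr => q _.
by rewrite -mulr_sumr.
Qed.

Lemma perm_inv_cond N v (Phi : op N.+1) : perm_inv Phi -> perm_inv (cond v Phi).
Proof.
move=> inv s f g; split; apply: eq_bigr => p _; apply: eq_bigr => q _.
  by rewrite (perm_inv_slice _ _ inv s f g).1.
by rewrite (perm_inv_slice _ _ inv s f g).2.
Qed.

Lemma tr_marg_slice N (Phi : op N.+2) p q :
  \sum_x marg (slice Phi p q) x x = marg Phi p q.
Proof. by rewrite /marg {2}/optr sum_pcons. Qed.

Lemma marg_slice_swap N (Phi : op N.+2) p q x y : perm_inv Phi ->
  marg (slice Phi p q) x y = marg (slice Phi x y) p q.
Proof.
move=> inv; apply: eq_bigr => s _; rewrite /slice.
by rewrite (perm_inv_swapl inv) (perm_inv_swapr inv).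
Qed.

(** Only the row indices are exchanged. Once the two-party marginal is nearly a product, this
    symmetry forces the one-party marginal to be nearly of rank one. *)
Lemma marg_slice_swapl N (Phi : op N.+2) p q x y : perm_inv Phi ->
  marg (slice Phi p q) x y = marg (slice Phi x q) p y.
Proof.
by move=> inv; apply: eq_bigr => s _; rewrite /slice (perm_inv_swapl inv).
Qed.

End Parties.

(** * The feasible cone *)

Section Cone.
Variable R : realType.
Local Notation C := (R[i]).
Variables n m k : nat.
Variables (X : 'M[C]_n) (L : {linear 'M[C]_n -> 'M[C]_m}) (Y : 'M[C]_m).
Local Notation D := ('I_n * 'I_k)%type.
Local Notation op N := ({ffun 'I_N -> D} -> {ffun 'I_N -> D} -> C).

Definition cone N (Phi : op N.+1) : Prop :=
  [/\ oppsd Phi, perm_inv Phi & ople (LamA L Phi) (YtrA Y Phi)].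

Definition tr2 (rho : D -> D -> C) : 'M[C]_n :=
  \matrix_(i, j) \sum_(l : 'I_k) rho (i, l) (j, l).

(** This is [Tr[(X (x) 1_k) rho]], the objective as a function of the one-party marginal. *)
Definition xval (rho : D -> D -> C) : C :=
  \sum_x \sum_y X x.1 y.1 * (x.2 == y.2)%:R * rho y x.

Lemma xval_tr2 rho : \tr (X *m tr2 rho) = xval rho.
Proof.
transitivity (\sum_i \sum_j \sum_l X i j * rho (j, l) (i, l)).
  apply: eq_bigr => i _; rewrite mxE; apply: eq_bigr => j _.
  by rewrite mxE mulr_sumr.
rewrite /xval sum_pair /=.
apply: eq_bigr => i _; rewrite exchange_big /=; apply: eq_bigr => l _.
rewrite [RHS]sum_pair /=; apply: eq_bigr => j _.
rewrite -[LHS](sum_delta l (fun l' => X i j * rho (j, l') (i, l))).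
by apply: eq_bigr => l' _; rewrite eq_sym; ring.
Qed.

Lemma xval_marg N (Phi : op N.+1) : optr (opmul (XtA X) Phi) = xval (marg Phi).
Proof.
rewrite /optr /opmul sum_pcons; apply: eq_bigr => x _.
under eq_bigr do rewrite sum_pcons.
rewrite exchange_big /=; apply: eq_bigr => y _; rewrite mulr_sumr.
apply: eq_bigr => s _.
rewrite -[RHS](sum_delta s (fun t => X x.1 y.1 * (x.2 == y.2)%:R * slice Phi y x t s)).
apply: eq_bigr => t _; rewrite /XtA !pcons_ord0 !ptl_pcons eq_sym /slice.
by rewrite (eq_sym s t); ring.
Qed.

(** [cond] removes the first party, on which the constraint for [Phi] acts. Swapping the first two
    parties makes the removed one a spectator of [L]. *)
Lemma LamA_cond N v (Phi : op N.+2) a b : perm_inv Phi ->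
  LamA L (cond v Phi) a b = \sum_p \sum_q (v p)^* * v q *
    LamA L Phi (a.1, pcons p a.2) (b.1, pcons q b.2).
Proof.
move=> inv; rewrite /LamA.
pose M p q := \matrix_(i, j) \sum_(l < k)
   Phi (pcons (i, l) (pcons p a.2)) (pcons (j, l) (pcons q b.2)).
have -> : (\matrix_(i, j) \sum_l cond v Phi (pcons (i, l) a.2) (pcons (j, l) b.2)) =
    \sum_p \sum_q ((v p)^* * v q) *: M p q.
  apply/matrixP => i j; rewrite mxE summxE exchange_big /=; apply: eq_bigr => p _.
  rewrite summxE exchange_big /=; apply: eq_bigr => q _.
  rewrite !mxE mulr_sumr; apply: eq_bigr => l _; rewrite /slice.
  by rewrite (perm_inv_swapl inv) (perm_inv_swapr inv).
rewrite linear_sum summxE; apply: eq_bigr => p _.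
rewrite linear_sum summxE; apply: eq_bigr => q _.
by rewrite linearZ mxE.
Qed.

Lemma YtrA_cond N v (Phi : op N.+2) a b : perm_inv Phi ->
  YtrA Y (cond v Phi) a b = \sum_p \sum_q (v p)^* * v q *
    YtrA Y Phi (a.1, pcons p a.2) (b.1, pcons q b.2).
Proof.
move=> inv; rewrite /YtrA mulr_sumr /cond.
under eq_bigr do rewrite mulr_sumr.
rewrite exchange_big /=; apply: eq_bigr => p _.
under eq_bigr do rewrite mulr_sumr.
rewrite exchange_big /=; apply: eq_bigr => q _.
rewrite !mulr_sumr; apply: eq_bigr => x _; rewrite /slice.
by rewrite (perm_inv_swapl inv) (perm_inv_swapr inv); ring.
Qed.

(** The constraint operator of [cond v Phi] is that of [Phi] compressed by [v] on a spectator party,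
    and compression preserves positivity. *)
Lemma cone_cond N v (Phi : op N.+2) : cone Phi -> cone (cond v Phi).
Proof.
case=> psd inv le; split; [exact: oppsd_cond|exact: perm_inv_cond|].
have := oppsd_pullback
  (fun z : D * ('I_m * {ffun 'I_N -> D}) => (z.2.1, pcons z.1 z.2.2)) le.
move/(oppsd_contract v); apply: eq_oppsd => a b /=.
rewrite LamA_cond // YtrA_cond // -sumrB; apply: eq_bigr => p _.
by rewrite -sumrB; apply: eq_bigr => q _; rewrite mulrBr.
Qed.

Lemma cone_lincomb N (J : finType) (c : J -> C) (Phi : J -> op N.+1) :
  (forall j, 0 <= c j) -> (forall j, cone (Phi j)) ->
  cone (fun f g => \sum_j c j * Phi j f g).
Proof.
move=> c0 cPhi; split.
- by apply: oppsd_lincomb => // j; case: (cPhi j).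
- move=> s f g; split; apply: eq_bigr => j _; case: (cPhi j) => _ inv _.
    by rewrite (inv s f g).1.
  by rewrite (inv s f g).2.
have : oppsd (fun a b => \sum_j c j *
    (YtrA Y (Phi j) a b - LamA L (Phi j) a b)).
  by apply: oppsd_lincomb => // j; case: (cPhi j).
apply: eq_oppsd => a b.
under eq_bigr do rewrite mulrBr.
rewrite sumrB; congr (_ - _).
  rewrite /YtrA mulr_sumr; under [RHS]eq_bigr do rewrite mulr_sumr.
  rewrite [RHS]exchange_big /=; apply: eq_bigr => j _.
  by rewrite !mulr_sumr; apply: eq_bigr => x _; ring.
rewrite /LamA.
pose M j := \matrix_(i, i') \sum_(l < k)
   Phi j (pcons (i, l) a.2) (pcons (i', l) b.2).
have -> : (\matrix_(i, i') \sum_l \sum_j c j * Phi j (pcons (i, l) a.2) (pcons (i', l) b.2))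
   = \sum_j c j *: M j.
  apply/matrixP => i i'; rewrite mxE summxE exchange_big /=; apply: eq_bigr => j _.
  by rewrite !mxE mulr_sumr.
by rewrite linear_sum summxE; apply: eq_bigr => j _; rewrite linearZ mxE.
Qed.

Lemma cone_scale N (c : C) (Phi : op N.+1) :
  0 <= c -> cone Phi -> cone (fun f g => c * Phi f g).
Proof.
move=> c0 cPhi.
have -> : (fun f g => c * Phi f g) = (fun f g => \sum_(j : unit) c * Phi f g).
  by apply/funext => f; apply/funext => g; rewrite big_const card_unit /= addr0.
exact: (@cone_lincomb _ unit (fun _ => c) (fun _ => Phi)).
Qed.

Definition ptrace N (Phi : op N.+1) : op N := fun f g => \sum_p slice Phi p p f g.

Lemma cond_delta N (Phi : op N.+1) p :
  cond (fun q => (q == p)%:R) Phi = slice Phi p p.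
Proof.
apply/funext => f; apply/funext => g; rewrite /cond.
rewrite -[RHS](sum_delta p (fun q => slice Phi q p f g)).
apply: eq_bigr => q _; rewrite conjC_nat.
rewrite -[slice Phi q p f g](sum_delta p (fun r => slice Phi q r f g)) mulr_sumr.
by apply: eq_bigr => r _; rewrite mulrA.
Qed.

(** The partial trace is the sum of the projections onto the basis vectors. *)
Lemma cone_ptrace N (Phi : op N.+2) : cone Phi -> cone (ptrace Phi).
Proof.
move=> cPhi.
have -> : ptrace Phi = fun f g => \sum_p 1 * cond (fun q => (q == p)%:R) Phi f g.
  apply/funext => f; apply/funext => g; apply: eq_bigr => p _.
  by rewrite mul1r cond_delta.
by apply: cone_lincomb => // p; exact: cone_cond.
Qed.

Lemma marg_ptrace N (Phi : op N.+2) x y : perm_inv Phi ->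
  marg (ptrace Phi) x y = marg Phi x y.
Proof.
move=> inv; rewrite -tr_marg_slice.
under [RHS]eq_bigr do rewrite (marg_slice_swap _ _ _ _ inv).
by rewrite /marg /optr exchange_big.
Qed.

(** Tracing the spectators out of the constraint leaves the original constraint on the marginal. *)
Lemma cone_marg N (Phi : op N.+1) : cone Phi ->
  mxle (L (tr2 (marg Phi))) (optr Phi *: Y).
Proof.
case=> _ _ le.
have : oppsd (fun a b : 'I_m => \sum_s (YtrA Y Phi (a, s) (b, s) - LamA L Phi (a, s) (b, s))).
  by apply: oppsd_sum => s; exact: (oppsd_pullback (fun a => (a, s)) le).
apply: eq_oppsd => a b; rewrite sumrB; congr (_ - _).
  by rewrite mxE optrE /YtrA /= -mulr_sumr mulrC exchange_big.
rewrite /LamA /=.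
have -> : tr2 (marg Phi) = \sum_s \matrix_(i, j) \sum_(l < k)
    Phi (pcons (i, l) s) (pcons (j, l) s).
  apply/matrixP => i j; rewrite mxE summxE exchange_big /=.
  by apply: eq_bigr => s _; rewrite mxE.
by rewrite linear_sum summxE.
Qed.

End Cone.

(** * Purification and product states *)

Section Factor.
Variable R : realType.
Local Notation C := (R[i]).

(** The form of the Schur complement at [u] is the form of [A] at [u - (s / r) e_i], the minimum
    over the added multiple of [e_i]. The extra point of [T + unit] is a second copy of [i] carrying
    that multiple. *)
Lemma oppsd_schur (T : finType) (A : T -> T -> C) (i : T) : oppsd A ->
  A i i != 0 -> oppsd (fun x y => A x y - A x i * A i y / A i i).
Proof.
move=> psdA r0 u; set r := A i i in r0 *.
have rr : r^* = r by apply: geC0_conj; exact: oppsd_diag.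
pose s := \sum_y A i y * u y.
have sE : \sum_x (u x)^* * A x i = s^*.
  rewrite /s rmorph_sum; apply: eq_bigr => x _.
  by rewrite rmorphM /= -(oppsd_herm i x psdA) mulrC.
pose w (z : T + unit) := if z is inl x then u x else - (s / r).
have := oppsd_pullback (fun z : T + unit => if z is inl x then x else i) psdA w.
have sumE (F : T + unit -> C) : \sum_z F z = \sum_x F (inl x) + F (inr tt).
  by rewrite big_sumType /= [X in _ + X](big_pred1 tt) // => -[].
under eq_bigr do rewrite sumE.
rewrite sumE /= -/r.
rewrite big_split /=.
under [X in _ + (X + _)]eq_bigr do rewrite -mulrA.
have -> : (- (s / r))^* = - (s^* / r).
  by rewrite rmorphN rmorphM /= fmorphV /= rr.
rewrite -mulr_suml sE -mulr_sumr -/s.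
congr (0 <= _).
have -> : \sum_x \sum_y (u x)^* * (A x y - A x i * A i y / r) * u y =
  \sum_x \sum_y (u x)^* * A x y * u y - s^* * s / r.
  rewrite -sE /s !mulr_suml -sumrB; apply: eq_bigr => x _.
  rewrite mulr_sumr mulr_suml -sumrB; apply: eq_bigr => y _.
  by field.
by field.
Qed.

(** The row space of the complement lies in that of [A], strictly so, because its column [i] is zero
    while row [i] of [A] has a nonzero entry there. *)
Lemma rank_schur n (A : 'M[C]_n) (i : 'I_n) : A i i != 0 ->
  (\rank (\matrix_(x, y) (A x y - A x i * A i y / A i i)%R) < \rank A)%N.
Proof.
move=> r0; set B := \matrix_(x, y) _; apply: rank_ltmx.
rewrite ltmxE; apply/andP; split.
  have -> : B = A - ((A i i)^-1 *: col i A) *m row i A.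
    apply/matrixP => x y; rewrite !mxE big_ord1 !mxE; congr (_ - _).
    by field.
  rewrite addmx_sub ?submx_refl // eqmx_opp mulmx_sub //; exact: row_sub.
apply/negP => /(submx_trans (row_sub i A)) /submxP[v /matrixP/(_ 0 i)].
rewrite !mxE big1 => [/eqP|x _]; first by rewrite (negPf r0).
rewrite !mxE mulfK // subrr mulr0 //.
Qed.

(** Pivoted Cholesky factorisation: each step splits off one column at a nonzero diagonal entry and
    lowers the rank. If no such entry exists, the trace vanishes and [A] is zero. *)
Lemma psdmx_factor n k (A : 'M[C]_n) : psdmx A -> (\rank A <= k)%N ->
  exists B : 'I_n -> nat -> C, forall x y, A x y = \sum_(l < k) B x l * (B y l)^*.
Proof.
elim: k A => [|k IH] A psdA.
  rewrite leqn0 mxrank_eq0 => /eqP ->; exists (fun _ _ => 0) => x y.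
  by rewrite big_ord0 mxE.
case: (pickP (fun i => A i i != 0)) => [i r0 rk|diag0 _]; last first.
  exists (fun _ _ => 0) => x y; rewrite big1 => [|l _]; last by rewrite mul0r.
  apply: (oppsd_tr0 _ _ psdA); apply: big1 => z _.
  by have /negbFE/eqP := diag0 z.
have psdB := oppsd_schur psdA r0.
have [||B BE] := IH (\matrix_(x, y) (A x y - A x i * A i y / A i i)).
- by apply: eq_oppsd psdB => x y; rewrite mxE.
- by rewrite -ltnS; apply: leq_trans rk; exact: rank_schur.
have Aii : 0 <= A i i by exact: (oppsd_diag i psdA).
pose q := sqrtC (A i i).
have qc : q^* = q by rewrite geC0_conj // sqrtC_ge0.
have qq : q * q = A i i by rewrite -expr2 sqrtCK.
have q0 : q != 0 by rewrite sqrtC_eq0.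
exists (fun x l => if l is l'.+1 then B x l' else A x i / q) => x y.
rewrite big_ord_recl /=; under eq_bigr do rewrite /bump /=.
rewrite -BE mxE rmorphM /= fmorphV /= qc -(oppsd_herm y i psdA) -qq.
by field.
Qed.

End Factor.

Section Product.
Variable R : realType.
Local Notation C := (R[i]).
Variables n m k : nat.
Variables (X : 'M[C]_n) (L : {linear 'M[C]_n -> 'M[C]_m}) (Y : 'M[C]_m).
Local Notation D := ('I_n * 'I_k)%type.
Local Notation op N := ({ffun 'I_N -> D} -> {ffun 'I_N -> D} -> C).
Variable psi : D -> C.

Definition prodvec N (f : {ffun 'I_N -> D}) : C := \prod_i psi (f i).
Definition prodop N : op N := fun f g => prodvec f * (prodvec g)^*.
Definition pure (x y : D) : C := psi x * (psi y)^*.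

Lemma prodvec_pcons N x (s : {ffun 'I_N -> D}) :
  prodvec (pcons x s) = psi x * prodvec s.
Proof.
rewrite /prodvec big_ord_recl pcons_ord0; congr (_ * _).
by apply: eq_bigr => j _; rewrite pcons_lift.
Qed.

Lemma prodop_pcons N x y (s t : {ffun 'I_N -> D}) :
  prodop (pcons x s) (pcons y t) = pure x y * prodop s t.
Proof. by rewrite /prodop !prodvec_pcons rmorphM /= /pure; ring. Qed.

Lemma oppsd_prodop N : oppsd (@prodop N).
Proof.
move=> u; pose z := \sum_f (u f)^* * prodvec f.
suff -> : \sum_f \sum_g (u f)^* * prodop f g * u g = z * z^* by exact: mul_conjC_ge0.
rewrite /z mulr_suml; apply: eq_bigr => f _.
rewrite rmorph_sum mulr_sumr; apply: eq_bigr => g _.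
by rewrite rmorphM /= conjCK /prodop; ring.
Qed.

Lemma perm_inv_prodop N : perm_inv (@prodop N).
Proof.
have pv (s : 'S_N) (f : {ffun 'I_N -> D}) : prodvec [ffun i => f (s i)] = prodvec f.
  rewrite /prodvec [RHS](reindex_inj (@perm_inj _ s)) /=.
  by apply: eq_bigr => i _; rewrite ffunE.
by move=> s f g; rewrite /prodop !pv.
Qed.

Hypothesis psi1 : optr pure = 1.

Lemma optr_prodop N : optr (@prodop N) = 1.
Proof.
elim: N => [|N IH].
  rewrite /optr (eq_bigr (fun _ => 1)) => [|f _].
    by rewrite sumr_const card_ffun card_ord expn0.
  by rewrite /prodop /prodvec !big_ord0 conjC1 mulr1.
rewrite /optr sum_pcons -[RHS]psi1; apply: eq_bigr => x _.
by under eq_bigr do rewrite prodop_pcons; rewrite -mulr_sumr -[X in _ * X]/(optr _) IH mulr1.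
Qed.

Lemma marg_prodop N x y : marg (@prodop N.+1) x y = pure x y.
Proof.
rewrite /marg /optr /slice; under eq_bigr do rewrite prodop_pcons.
by rewrite -mulr_sumr -[X in _ * X]/(optr _) optr_prodop mulr1.
Qed.

(** The constraint operator factors as [Y - L (tr2 pure)] tensored with a product projector, so
    contracting [u] with [prodvec] reduces to the one-party inequality. *)
Lemma cone_prodop N : mxle (L (tr2 pure)) Y -> cone L Y (@prodop N.+1).
Proof.
move=> le; split; [exact: oppsd_prodop|exact: perm_inv_prodop|] => u.
pose w a := \sum_t (prodvec t)^* * u (a, t).
suff -> : \sum_a \sum_b (u a)^* *
    (YtrA Y (@prodop N.+1) a b - LamA L (@prodop N.+1) a b) * u b =
  \sum_a \sum_b (w a)^* * (Y a b - L (tr2 pure) a b) * w b by exact: le.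
have WE a b : YtrA Y (@prodop N.+1) a b - LamA L (@prodop N.+1) a b =
    (Y a.1 b.1 - L (tr2 pure) a.1 b.1) * prodop a.2 b.2.
  rewrite mulrBl; congr (_ - _).
    rewrite /YtrA; congr (_ * _); under eq_bigr do rewrite prodop_pcons.
    by rewrite -mulr_suml -[X in X * _]/(optr pure) psi1 mul1r.
  rewrite /LamA.
  have -> : (\matrix_(i, j) \sum_l prodop (pcons (i, l) a.2) (pcons (j, l) b.2)) =
      prodop a.2 b.2 *: tr2 pure.
    apply/matrixP => i j; rewrite !mxE mulr_sumr; apply: eq_bigr => l _.
    by rewrite prodop_pcons mulrC.
  by rewrite linearZ mxE mulrC.
rewrite sum_pair; apply: eq_bigr => a _.
under eq_bigr do rewrite sum_pair.
rewrite exchange_big /=; apply: eq_bigr => b _.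
rewrite {1}/w rmorph_sum !mulr_suml; apply: eq_bigr => s _.
rewrite /w mulr_sumr; apply: eq_bigr => t _.
by rewrite WE rmorphM /= conjCK /prodop; ring.
Qed.

End Product.

(** * Real Hilbert-Schmidt geometry of operators *)

Section Inner.
Variable R : realType.
Local Notation C := (R[i]).
Local Notation cRe := (@complex.Re R).
Local Notation cIm := (@complex.Im R).
Variable D : finType.
Implicit Types rho sigma : D -> D -> C.

Definition nsq (z : C) : R := cRe z ^+ 2 + cIm z ^+ 2.

(** The real part of the Hilbert-Schmidt inner product. *)
Definition inner rho sigma : R :=
  \sum_x \sum_y (cRe (rho x y) * cRe (sigma x y) + cIm (rho x y) * cIm (sigma x y)).

Lemma nsq_ge0 z : 0 <= nsq z.
Proof. by rewrite addr_ge0 // sqr_ge0. Qed.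

Lemma inner_nsq rho : inner rho rho = \sum_x \sum_y nsq (rho x y).
Proof. by apply: eq_bigr => x _; apply: eq_bigr => y _; rewrite /nsq !expr2. Qed.

Lemma inner_ge0 rho : 0 <= inner rho rho.
Proof.
by rewrite inner_nsq; apply: sumr_ge0 => x _; apply: sumr_ge0 => y _; exact: nsq_ge0.
Qed.

Lemma nsq_le_inner rho x y : nsq (rho x y) <= inner rho rho.
Proof.
rewrite inner_nsq (bigD1 x) //= (bigD1 y) //= -addrA lerDl addr_ge0 //.
  by apply: sumr_ge0 => z _; exact: nsq_ge0.
by apply: sumr_ge0 => w _; apply: sumr_ge0 => z _; exact: nsq_ge0.
Qed.

Lemma inner_sub rho sigma (t : R) :
  let tau x y := sigma x y - Complex t 0 * rho x y in
  inner tau tau = inner sigma sigma - 2 * t * inner sigma rho + t ^+ 2 * inner rho rho.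
Proof.
move=> tau; rewrite /inner 2!mulr_sumr -sumrB -big_split /=; apply: eq_bigr => x _.
rewrite 2!mulr_sumr -sumrB -big_split /=; apply: eq_bigr => y _.
by rewrite /tau !(ReD, ImD, ReN, ImN, ReM, ImM) /=; ring.
Qed.

Lemma inner_scale rho (t : R) :
  let tau x y := Complex t 0 * rho x y in inner tau tau = t ^+ 2 * inner rho rho.
Proof.
move=> tau; rewrite /inner mulr_sumr; apply: eq_bigr => x _.
rewrite mulr_sumr; apply: eq_bigr => y _.
by rewrite /tau !(ReM, ImM) /=; ring.
Qed.

Lemma inner_suml (J : finType) (sigma : J -> D -> D -> C) rho (c : R) :
  (forall x y, \sum_j sigma j x y = Complex c 0 * rho x y) ->
  \sum_j inner (sigma j) rho = c * inner rho rho.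
Proof.
move=> sE; rewrite /inner exchange_big mulr_sumr /=; apply: eq_bigr => x _.
rewrite exchange_big mulr_sumr /=; apply: eq_bigr => y _.
rewrite big_split /= -!mulr_suml -Re_sum -Im_sum sE ReM ImM /=; ring.
Qed.

Lemma inner_le rho : (forall x y, `|cRe (rho x y)| <= 1 /\ `|cIm (rho x y)| <= 1) ->
  inner rho rho <= 2 * (#|D| * #|D|)%:R.
Proof.
move=> b; apply: (@le_trans _ _ (\sum_(x : D) \sum_(y : D) 2)).
  apply: ler_sum => x _; apply: ler_sum => y _.
  have [] := b x y; rewrite !ler_norml => /andP[? ?] /andP[? ?]; nra.
by rewrite !sumr_const -mulrnA mulr_natr.
Qed.

Lemma nsqB (z w : C) : nsq (z - w) <= 2 * nsq z + 2 * nsq w.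
Proof.
rewrite /nsq !(ReD, ImD, ReN, ImN).
have := sqr_ge0 (cRe z + cRe w); have := sqr_ge0 (cIm z + cIm w); nra.
Qed.

End Inner.

(** * Polarisation vectors and their resolution of the identity *)

Section Polarisation.
Variable R : realType.
Local Notation C := (R[i]).
Variable D : finType.

Definition im : C := Complex 0 1.

Definition polvec (j : D * D * 'I_4) (x : D) : C :=
  (x == j.1.1)%:R + im ^+ j.2 * (x == j.1.2)%:R.

Lemma im2 : im * im = -1.
Proof. by apply: complex_ext; rewrite /= ?mulr0 ?mulr1 ?mul0r ?mul1r /=; ring. Qed.

Lemma conj_im : im^* = - im.
Proof. by apply: complex_ext; rewrite ?ReC ?ImC ?ReN ?ImN /= ?oppr0. Qed.

Lemma im_unit a : (im ^+ a)^* * im ^+ a = 1.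
Proof.
rewrite rmorphXn /= -exprMn conj_im mulNr im2 opprK; exact: expr1n.
Qed.

Lemma polvec_form p q a (T : D -> D -> C) :
  \sum_x \sum_y (polvec (p, q, a) x)^* * polvec (p, q, a) y * T x y =
  T p p + T q q + im ^+ a * T p q + (im ^+ a)^* * T q p.
Proof.
have E b (F : D -> C) : \sum_x ((x == p)%:R + b * (x == q)%:R) * F x = F p + b * F q.
  rewrite -(sum_delta p F) -(sum_delta q F) mulr_sumr -big_split /=.
  by apply: eq_bigr => x _; ring.
transitivity (\sum_x ((x == p)%:R + (im ^+ a)^* * (x == q)%:R) *
   (T x p + im ^+ a * T x q)).
  apply: eq_bigr => x _; rewrite -E mulr_sumr; apply: eq_bigr => y _.
  by rewrite /polvec /= rmorphD rmorphM /= !conjC_nat; ring.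
rewrite E -[T q q in RHS]mul1r -(im_unit a); ring.
Qed.

(** Summing over the four phases kills the cross terms and leaves [4 T p p + 4 T q q]; summing over
    [p] and [q] gives the factor [8 #|D|]. *)
Lemma polvec_resolution (T : D -> D -> C) :
  \sum_j \sum_x \sum_y (polvec j x)^* * polvec j y * T x y =
  (8 * #|D|)%:R * \sum_x T x x.
Proof.
rewrite sum_pair sum_pair.
transitivity (\sum_p \sum_q (4%:R * T p p + 4%:R * T q q)).
  apply: eq_bigr => p _; apply: eq_bigr => q _.
  rewrite !big_ord_recl big_ord0 !polvec_form /= /bump /=.
  rewrite !(exprS, expr0) !rmorphM /= rmorph1 conj_im.
  have := im2; set i := im => i2; ring: i2.
under eq_bigr do rewrite big_split /= sumr_const -mulr_sumr -[X in X + _]mulr_natr.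
rewrite big_split /= -mulr_suml -mulr_sumr sumr_const -[X in _ + X]mulr_natr natrM.
by ring.
Qed.

Lemma polvec_polarisation p q (T : D -> D -> C) :
  \sum_(a < 4) (im ^+ a)^* *
    (\sum_x \sum_y (polvec (p, q, a) x)^* * polvec (p, q, a) y * T x y) =
  4%:R * T p q.
Proof.
rewrite !big_ord_recl big_ord0 !polvec_form /= /bump /=.
rewrite !(exprS, expr0) !rmorphM /= rmorph1 conj_im.
have := im2; set i := im => i2; ring: i2.
Qed.

(** Cauchy-Schwarz for four terms with unimodular weights. *)
Lemma nsq_pol (z : 'I_4 -> C) (K : R) : (forall a, nsq (z a) <= K) ->
  nsq (\sum_(a < 4) (im ^+ a)^* * z a) <= 16 * K.
Proof.
move=> zK.
rewrite !big_ord_recl big_ord0 /= /bump /=.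
rewrite !(exprS, expr0) !rmorphM /= rmorph1 conj_im.
move: (zK ord0) (zK (lift ord0 ord0)) (zK (lift ord0 (lift ord0 ord0)))
  (zK (lift ord0 (lift ord0 (lift ord0 ord0)))).
move: (z _) (z _) (z _) (z _) => z3 z2 z1 z0.
case: z0 => a0 b0; case: z1 => a1 b1; case: z2 => a2 b2; case: z3 => a3 b3.
rewrite /nsq !(ReD, ImD, ReN, ImN, ReM, ImM) /=.
move=> h0 h1 h2 h3.
have sq4 (a b c d : R) : (a + b + c + d) ^+ 2 <= 4 * (a ^+ 2 + b ^+ 2 + c ^+ 2 + d ^+ 2).
  have := sqr_ge0 (a - b); have := sqr_ge0 (a - c); have := sqr_ge0 (a - d).
  have := sqr_ge0 (b - c); have := sqr_ge0 (b - d); have := sqr_ge0 (c - d); nra.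
have h := lerD (sq4 a0 b1 (- a2) (- b3)) (sq4 b0 (- a1) (- b2) a3).
apply: (le_trans (le_trans _ h)); last by rewrite !sqrrN; lra.
by rewrite le_eqVlt; apply/orP; left; apply/eqP; ring.
Qed.

End Polarisation.

(** * Decoupling of nearly optimal states *)

Section Decoupling.
Variable R : realType.
Local Notation C := (R[i]).
Local Notation cRe := (@complex.Re R).
Local Notation cIm := (@complex.Im R).
Variables n m k : nat.
Variables (X : 'M[C]_n) (L : {linear 'M[C]_n -> 'M[C]_m}) (Y : 'M[C]_m).
Local Notation D := ('I_n * 'I_k)%type.
Local Notation op N := ({ffun 'I_N -> D} -> {ffun 'I_N -> D} -> C).
Local Notation cone := (cone L Y).
Local Notation rval rho := (cRe (xval X rho)).

Definition energy (e : R) (rho : D -> D -> C) : R := rval rho + e * inner rho rho.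

Lemma rval_scale (t : R) (rho : D -> D -> C) :
  rval (fun x y => Complex t 0 * rho x y) = t * rval rho.
Proof.
have -> : xval X (fun x y => Complex t 0 * rho x y) = Complex t 0 * xval X rho.
  rewrite /xval mulr_sumr; apply: eq_bigr => x _; rewrite mulr_sumr.
  by apply: eq_bigr => y _; ring.
by rewrite ReM /= mul0r subr0.
Qed.

Lemma rval_sum (J : finType) (sigma : J -> D -> D -> C) (rho : D -> D -> C) (c : R) :
  (forall x y, \sum_j sigma j x y = Complex c 0 * rho x y) ->
  \sum_j rval (sigma j) = c * rval rho.
Proof.
move=> sE; rewrite -Re_sum -rval_scale; congr cRe.
rewrite /xval exchange_big /=; apply: eq_bigr => x _.
rewrite exchange_big /=; apply: eq_bigr => y _.
by rewrite -mulr_sumr sE.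
Qed.

Definition rval_max : R :=
  \sum_(x : D) \sum_(y : D) 
    (`|cRe (X x.1 y.1 * (x.2 == y.2)%:R)| + `|cIm (X x.1 y.1 * (x.2 == y.2)%:R)|).

Lemma rval_le (rho : D -> D -> C) : (forall x y, `|cRe (rho x y)| <= 1 /\ `|cIm (rho x y)| <= 1) ->
  rval rho <= rval_max.
Proof.
move=> b; rewrite Re_sum; apply: ler_sum => x _; rewrite Re_sum; apply: ler_sum => y _.
rewrite ReM; move: (X _ _ * _) (rho y x) (b y x) => z w [b1 b2].
apply: le_trans (ler_norm _) (le_trans (ler_normB _ _) _); rewrite !normrM.
by apply: lerD; rewrite ler_piMr.
Qed.

Lemma marg_scale N (c : C) (Phi : op N.+1) x y :
  marg (fun f g => c * Phi f g) x y = c * marg Phi x y.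
Proof. by rewrite /marg /optr mulr_sumr. Qed.

Variables (e G : R) (N : nat).
Hypothesis e_gt0 : 0 < e.
Hypothesis energy_le : forall Phi : op N.+1, cone Phi -> optr Phi = 1 ->
  energy e (marg Phi) <= G.

(** The energy bound for [Psi / t], multiplied by [t ^+ 2]. At [t = 0] positivity makes the marginal
    vanish. *)
Lemma energy_homogeneous (Psi : op N.+1) (t : R) : cone Psi ->
  t = cRe (optr Psi) ->
  t * rval (marg Psi) + e * inner (marg Psi) (marg Psi) <= G * t ^+ 2.
Proof.
move=> cPsi tdef; have [psd _ _] := cPsi.
have /ge0_complexP[im0 t0] := optr_ge0 psd; rewrite -tdef in t0.
have tE : optr Psi = Complex t 0 by apply: complex_ext.
have [tz|tn0] := eqVneq t 0.
  have mz x y : marg Psi x y = 0.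
    apply: (oppsd_tr0 _ _ (oppsd_marg psd)).
    by rewrite -optrE tE tz.
  rewrite tz mul0r add0r expr0n mulr0 /inner.
  rewrite big1 ?mulr0 // => x _; rewrite big1 // => y _.
  by rewrite mz /= !mul0r addr0.
have tp : 0 < t by rewrite lt_neqAle eq_sym tn0.
pose Phi : op N.+1 := fun f g => Complex t^-1 0 * Psi f g.
have trPhi : optr Phi = 1.
  rewrite /optr -mulr_sumr -/(optr Psi) tE.
  by apply: complex_ext; rewrite /= ?mulVf // ?mul0r ?mulr0 ?subr0 ?addr0.
have cPhi : cone Phi.
  by apply: cone_scale => //; apply/ge0_complexP; rewrite /= invr_ge0.
have := energy_le cPhi trPhi.
have -> : marg Phi = fun x y => Complex t^-1 0 * marg Psi x y.
  by apply/funext => x; apply/funext => y; exact: marg_scale.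
rewrite /energy rval_scale inner_scale.
have t2 : 0 < t ^+ 2 by rewrite exprn_gt0.
rewrite -(ler_pM2r t2); congr (_ <= _).
by field.
Qed.

(* Affine in (Psi, t): this is what makes the defects of a resolution of the
   identity add up, although the energy itself is quadratic. *)
Definition defect (rho : D -> D -> C) (Psi : op N.+1) : R :=
  let t := cRe (optr Psi) in
  G * t - rval (marg Psi) - 2 * e * inner (marg Psi) rho + e * t * inner rho rho.

(** Completing the square: [t * defect rho Psi] is the slack of [energy_homogeneous] plus [e] times
    the squared norm of [marg Psi - t rho]. *)
Lemma defect_bound rho (Psi : op N.+1) : cone Psi ->
  let t := cRe (optr Psi) in
  (forall x y, e * nsq (marg Psi x y - Complex t 0 * rho x y) <= t * defect rho Psi)
  /\ 0 <= defect rho Psi.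
Proof.
move=> cPsi t; have hom := energy_homogeneous cPsi (erefl t).
have [psd _ _] := cPsi.
have /ge0_complexP[im0 t0] := optr_ge0 psd; rewrite -/t in t0.
pose tau x y := marg Psi x y - Complex t 0 * rho x y.
have le : e * inner tau tau <= t * defect rho Psi.
  rewrite inner_sub /defect -/t; nra.
split=> [x y|].
  apply: le_trans le; rewrite ler_pM2l //; exact: (nsq_le_inner tau).
have [tz|tn0] := eqVneq t 0; last first.
  have tp : 0 < t by rewrite lt_neqAle eq_sym tn0.
  rewrite -(pmulr_rge0 _ tp); apply: le_trans le.
  by rewrite mulr_ge0 ?inner_ge0 ?ltW.
have mz x y : marg Psi x y = 0.
  apply: (oppsd_tr0 _ _ (oppsd_marg psd)); rewrite -optrE.
  by apply: complex_ext.
rewrite /defect -/t tz !mulr0 mul0r addr0 sub0r.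
have -> : rval (marg Psi) = 0.
  rewrite /xval big1 // => x _; rewrite big1 // => y _; by rewrite mz mulr0.
rewrite oppr0 sub0r /inner big1 ?mulr0 ?oppr0 // => x _.
by rewrite big1 // => y _; rewrite mz /= !mul0r addr0.
Qed.

(** The nonnegative defects of the projections onto the [polvec j] have a small sum, so each is
    small and each conditional marginal is close to a multiple of [rho]. Polarisation carries this
    over to every block [slice Phi p q]. *)
Lemma decoupling (Phi : op N.+2) : cone Phi -> optr Phi = 1 ->
  let rho := marg Phi in
  forall p q x y, e * nsq (marg (slice Phi p q) x y - rho p q * rho x y) <=
    (8 * #|{: D}|)%:R ^+ 2 * (G - energy e rho).
Proof.
move=> cPhi tr1 rho p q x y; have [psd inv _] := cPhi.
set c : R := (8 * #|{: D}|)%:R.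
have cE : Complex c 0 = (8 * #|{: D}|)%:R.
  by rewrite /c -(rmorph_nat (real_complex R)).
pose Psi j := cond (polvec R j) Phi.
pose t j := cRe (optr (Psi j)).
have cPsi j : cone (Psi j) by exact: cone_cond.
have t0 j : 0 <= t j /\ optr (Psi j) = Complex (t j) 0.
  have [psdj _ _] := cPsi j; have /ge0_complexP[i0 ?] := optr_ge0 psdj.
  by split=> //; apply: complex_ext.
have sumt : \sum_j t j = c.
  rewrite -Re_sum; under eq_bigr do rewrite optr_cond.
  by rewrite polvec_resolution -/(optr _) -optrE tr1 mulr1 -cE.
have sums u v : \sum_j marg (Psi j) u v = Complex c 0 * rho u v.
  under eq_bigr do rewrite marg_cond.
  rewrite (polvec_resolution (fun p q => marg (slice Phi p q) u v)) cE.
  under eq_bigr do rewrite (marg_slice_swap _ _ _ _ inv).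
  by rewrite tr_marg_slice.
(* The conditional marginals sum to [c rho], so the terms [- 2 e] and [+ e] in the defect combine to
   the [- e] of the energy. *)
have sumd : \sum_j defect rho (Psi j) = c * (G - energy e rho).
  rewrite /defect big_split /= !sumrB.
  rewrite -mulr_sumr -/t -mulr_suml -!mulr_sumr -/t.
  rewrite (rval_sum sums) (inner_suml sums) sumt /energy; ring.
have tc j : t j <= c.
  rewrite -sumt (bigD1 j) //= lerDl; apply: sumr_ge0 => j' _.
  by have [] := t0 j'.
have dc j : 0 <= defect rho (Psi j) <= c * (G - energy e rho).
  have d0 j' := (defect_bound rho (cPsi j')).2.
  rewrite d0 /= -sumd (bigD1 j) //= lerDl; exact: sumr_ge0.
set K := c ^+ 2 * (G - energy e rho).
have bj j u v : nsq (marg (Psi j) u v - optr (Psi j) * rho u v) <= K / e.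
  rewrite ler_pdivlMr // mulrC (t0 j).2.
  apply: le_trans ((defect_bound rho (cPsi j)).1 u v) _.
  rewrite /K expr2 -mulrA; case/andP: (dc j) => d0 d1.
  by apply: ler_pM => //; [have [] := t0 j|exact: tc].
have := nsq_pol (z := fun a => marg (Psi (p, q, a)) x y - optr (Psi (p, q, a)) * rho x y)
  (fun a => bj (p, q, a) x y).
have -> : \sum_(a < 4) (im R ^+ a)^* *
    (marg (Psi (p, q, a)) x y - optr (Psi (p, q, a)) * rho x y) =
    Complex 4 0 * (marg (slice Phi p q) x y - rho p q * rho x y).
  have -> : Complex 4 0 = 4%:R :> C by rewrite -(rmorph_nat (real_complex R)).
  rewrite mulrBr mulrA -(polvec_polarisation p q rho).
  rewrite -(polvec_polarisation p q (fun p q => marg (slice Phi p q) x y)).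
  rewrite mulr_suml -sumrB; apply: eq_bigr => a _.
  by rewrite mulrBr mulrA optr_cond marg_cond.
(* The polarisation factor 4, once squared, cancels the 16 of [nsq_pol]. *)
rewrite /nsq !(ReM, ImM) /= => h.
rewrite mulrC -ler_pdivlMr //.
set a := cRe _ in h *; set b := cIm _ in h *; nra.
Qed.

End Decoupling.

(** * Limits along an ultrafilter *)

Section UltraLimits.
Variable R : realType.
Local Notation C := (R[i]).
Local Notation cRe := (@complex.Re R).
Local Notation cIm := (@complex.Im R).
Context (U : set_system nat) {ultraU : UltraFilter U}.
Local Open Scope classical_set_scope.

(** Compactness gives a cluster point, and a cluster point of an ultrafilter is a limit. *)
Lemma ultra_bounded_cvg (u : nat -> R) (b : R) : (forall i, `|u i| <= b) ->
  exists l : R, u @ U --> l.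
Proof.
move=> ub.
have [|l [_ cl]] := @segment_compact R (- b) b (u @ U) _.
  by apply: (@filterE _ U) => i /=; rewrite in_itv /= -ler_norml.
exists l => A lA; have [//|UA] := in_ultra_setVsetC (u @^-1` A) ultraU.
by have [z []] := cl (~` A) A UA lA.
Qed.

Definition ccvg (z : nat -> C) (l : C) : Prop :=
  (cRe (z i) @[i --> U] --> cRe l) /\ (cIm (z i) @[i --> U] --> cIm l).

Lemma ccvg_cst (a : C) : ccvg (fun _ => a) a.
Proof. by split; exact: cvg_cst. Qed.

Lemma ccvgD z w a b : ccvg z a -> ccvg w b -> ccvg (fun i => z i + w i) (a + b).
Proof.
move=> [h1 h2] [h3 h4]; split.
  by rewrite ReD; under eq_fun do rewrite ReD; exact: cvgD.
by rewrite ImD; under eq_fun do rewrite ImD; exact: cvgD.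
Qed.

Lemma ccvgM z w a b : ccvg z a -> ccvg w b -> ccvg (fun i => z i * w i) (a * b).
Proof.
move=> [h1 h2] [h3 h4]; split.
  by rewrite ReM; under eq_fun do rewrite ReM; apply: cvgB; exact: cvgM.
by rewrite ImM; under eq_fun do rewrite ImM; apply: cvgD; exact: cvgM.
Qed.

Lemma ccvgB z w a b : ccvg z a -> ccvg w b -> ccvg (fun i => z i - w i) (a - b).
Proof.
move=> [h1 h2] [h3 h4]; split.
  by rewrite ReD ReN; under eq_fun do rewrite ReD ReN; exact: cvgB.
by rewrite ImD ImN; under eq_fun do rewrite ImD ImN; exact: cvgB.
Qed.

Lemma ccvg_sum (J : finType) (z : J -> nat -> C) (a : J -> C) :
  (forall j, ccvg (z j) (a j)) -> ccvg (fun i => \sum_j z j i) (\sum_j a j).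
Proof.
move=> za; elim: (index_enum J) => [|j s IH].
  by rewrite big_nil; under eq_fun do rewrite big_nil; exact: ccvg_cst.
by rewrite big_cons; under eq_fun do rewrite big_cons; exact: ccvgD.
Qed.

Lemma ccvg_ge0 z a : ccvg z a -> (forall i, 0 <= z i) -> 0 <= a.
Proof.
move=> [h1 h2] z0; apply/ge0_complexP; split.
  have z_im : (fun i => cIm (z i)) = fun=> 0.
    by apply/funext => i; have /ge0_complexP[] := z0 i.
  by move: h2; rewrite z_im => h2; exact: (cvg_unique _ h2 (cvg_cst 0)).
apply: (@closed_cvg _ _ _ _ _ (fun r : R => 0 <= r) _ _ _ h1); first exact: closed_ge.
by apply: filterE => i; have /ge0_complexP[] := z0 i.
Qed.

Lemma ccvg_oppsd (T : finType) (A : nat -> T -> T -> C) (B : T -> T -> C) :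
  (forall x y, ccvg (fun i => A i x y) (B x y)) -> (forall i, oppsd (A i)) -> oppsd B.
Proof.
move=> AB psdA u; apply: ccvg_ge0; last by move=> i; exact: (psdA i u).
apply: ccvg_sum => x; apply: ccvg_sum => y.
by apply: ccvgM (ccvgM (ccvg_cst _) (AB x y)) (ccvg_cst _).
Qed.

(** Expanding in matrix units makes each entry of [L M] a finite linear combination of entries of
    [M]. *)
Lemma ccvg_linear n m (L : {linear 'M[C]_n -> 'M[C]_m}) (A : nat -> 'M[C]_n)
    (B : 'M[C]_n) :
  (forall x y, ccvg (fun i => A i x y) (B x y)) ->
  forall a b, ccvg (fun i => L (A i) a b) (L B a b).
Proof.
move=> AB a b.
have LE M : L M a b = \sum_i \sum_j M i j * L (delta_mx i j) a b.
  rewrite {1}[M]matrix_sum_delta linear_sum summxE; apply: eq_bigr => i _.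
  by rewrite linear_sum summxE; apply: eq_bigr => j _; rewrite linearZ mxE.
rewrite LE; under eq_fun do rewrite LE.
apply: ccvg_sum => x; apply: ccvg_sum => y.
exact: ccvgM (AB x y) (ccvg_cst _).
Qed.

End UltraLimits.

(** * The limit of the hierarchy *)

Section DeFinetti.
Variable R : realType.
Local Notation C := (R[i]).
Local Notation cRe := (@complex.Re R).
Local Notation cIm := (@complex.Im R).
Variables n m k : nat.
Variables (X : 'M[C]_n) (L : {linear 'M[C]_n -> 'M[C]_m}) (Y : 'M[C]_m).
Local Notation D := ('I_n * 'I_k)%type.
Local Notation op N := ({ffun 'I_N -> D} -> {ffun 'I_N -> D} -> C).
Local Notation cone := (cone L Y).
Local Notation rval rho := (cRe (xval X rho)).
Variable c : R.
Hypothesis feasible : forall N, exists Phi : op N.+1,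
  [/\ cone Phi, optr Phi = 1 & c <= rval (marg Phi)].

Lemma oppsd_bound1 (rho : D -> D -> C) : oppsd rho -> optr rho = 1 ->
  forall x y, `|cRe (rho x y)| <= 1 /\ `|cIm (rho x y)| <= 1.
Proof. by move=> psd tr1 x y; have := oppsd_bound x y psd; rewrite tr1. Qed.

(** [S] collects the energy levels reached for every number of parties. Slightly above [sup S] some
    [N] fails, which gives the upper bound; slightly below, every number of parties succeeds, in
    particular one more than at that [N]. *)
Lemma almost_maximal_energy (e eta : R) : 0 < e -> 0 < eta ->
  exists N (G : R), (forall Phi : op N.+1, cone Phi -> optr Phi = 1 ->
      energy X e (marg Phi) <= G) /\
    exists Phi : op N.+2, [/\ cone Phi, optr Phi = 1,
      c - eta <= energy X e (marg Phi) & G - energy X e (marg Phi) <= eta].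
Proof.
move=> e0 eta0.
pose S : set R := [set r | forall N, exists Phi : op N.+1,
  [/\ cone Phi, optr Phi = 1 & r <= energy X e (marg Phi)]]%classic.
have Sc : S c.
  move=> N; have [Phi [cPhi tr1 le]] := feasible N; exists Phi; split=> //.
  apply: le_trans le _; rewrite lerDl mulr_ge0 ?inner_ge0 //; exact: ltW.
have supS : has_sup S.
  split; first by exists c.
  exists (rval_max k X + e * (2 * (#|{: D}| * #|{: D}|)%:R)) => r /(_ 0%N)[Phi [[psd _ _] tr1 le]].
  have b := oppsd_bound1 (oppsd_marg psd) (etrans (esym (optrE Phi)) tr1).
  by apply: le_trans le _; rewrite lerD ?rval_le // ler_pM2l // inner_le.
have eta2 : 0 < eta / 2 by rewrite divr_gt0.
have [N Nle] : exists N, forall Phi : op N.+1, cone Phi -> optr Phi = 1 ->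
    energy X e (marg Phi) <= sup S + eta / 2.
  apply: contrapT => nex.
  suff : S (sup S + eta / 2) by move/(sup_upper_bound supS); lra.
  move=> N; apply: contrapT => nPhi; apply: nex; exists N => Phi cPhi tr1.
  rewrite leNgt; apply/negP => lt; apply: nPhi; exists Phi; split=> //; exact: ltW.
exists N, (sup S + eta / 2); split=> //.
have [r Sr ltr] := sup_adherent eta2 supS.
have [Phi [cPhi tr1 le]] := Sr N.+1; exists Phi.
by have := sup_upper_bound supS Sc; split=> //; lra.
Qed.

Lemma almost_pure (delta : R) : 0 < delta -> exists rho : D -> D -> C,
  [/\ oppsd rho, optr rho = 1, mxle (L (tr2 rho)) Y, c - delta <= rval rho
    & forall p q x y, nsq (rho p q * rho x y - rho x q * rho p y) <= delta].
Proof.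
move=> d0.
pose M : R := 2 * (#|{: D}| * #|{: D}|)%:R + 1.
pose K : R := (8 * #|{: D}|)%:R ^+ 2.
have M0 : 0 < M by rewrite ltr_wpDl.
have K0 : 0 <= K by rewrite exprn_ge0.
(* [M] exceeds every squared norm of a state, so the perturbation costs at most [delta / 2] of the
   objective. *)
pose e := delta / 2 / M.
have e0 : 0 < e by rewrite !divr_gt0.
(* The first bound pays the rest of the objective loss; the second makes each decoupling error at
   most [delta / 4], and two of them combine to [delta] in [nsqB]. *)
pose eta := Num.min (delta / 2) (delta * e / (4 * (K + 1))).
have eta0 : 0 < eta.
  rewrite lt_min divr_gt0 //= divr_gt0 // mulr_gt0 //.
  by rewrite ltr_wpDl.
have [N [G [Gle [Phi [cPhi tr1 le1 le2]]]]] := almost_maximal_energy e0 eta0.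
have [psd inv _] := cPhi.
have psdr := oppsd_marg psd.
have trr : optr (marg Phi) = 1 by rewrite -optrE.
have b := oppsd_bound1 psdr trr.
exists (marg Phi); split=> //.
- by have := cone_marg cPhi; rewrite tr1 scale1r.
- have eM : e * M = delta / 2 by rewrite divfK // gt_eqF.
  have : e * inner (marg Phi) (marg Phi) <= e * M.
    rewrite ler_pM2l //; apply: le_trans (inner_le b) _; rewrite lerDl //.
  have : eta <= delta / 2 by rewrite ge_min lexx.
  by move: le1; rewrite /energy; lra.
move=> p q x y.
have bound p' q' x' y' : nsq (marg (slice Phi p' q') x' y' - marg Phi p' q' * marg Phi x' y')
    <= delta / 4.
  have := decoupling e0 Gle cPhi tr1 p' q' x' y'; rewrite -/K.
  set z := nsq _ => dec.
  have h1 : K * (G - energy X e (marg Phi)) <= K * eta by rewrite ler_wpM2l.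
  have h2 : (K + 1) * eta <= delta * e / 4.
    have : eta <= delta * e / (4 * (K + 1)) by rewrite ge_min lexx orbT.
    rewrite -(@ler_pM2l _ (K + 1)) ?ltr_wpDl // => /le_trans; apply.
    rewrite le_eqVlt; apply/orP; left; apply/eqP; field.
    by rewrite gt_eqF // ltr_wpDl.
  rewrite -(ler_pM2l e0); nra.
set u := marg (slice Phi p q) x y - marg Phi p q * marg Phi x y.
set v := marg (slice Phi x q) p y - marg Phi x q * marg Phi p y.
have -> : marg Phi p q * marg Phi x y - marg Phi x q * marg Phi p y = v - u.
  by rewrite /u /v (marg_slice_swapl x q p y inv); ring.
apply: le_trans (nsqB _ _) _.
have := bound p q x y; have := bound x q p y; rewrite -/u -/v; lra.
Qed.

(** All the conditions of [almost_pure] are closed, so they pass to a limit as [delta] tends to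
    0. *)
Lemma exact_pure : exists rho : D -> D -> C,
  [/\ oppsd rho, optr rho = 1, mxle (L (tr2 rho)) Y, c <= rval rho
    & forall p q x y, rho p q * rho x y = rho x q * rho p y].
Proof.
have h0 i : 0 < harmonic i :> R by rewrite /harmonic invr_gt0.
have /choice[r rP] : forall i, exists rho : D -> D -> C,
  [/\ oppsd rho, optr rho = 1, mxle (L (tr2 rho)) Y, c - harmonic i <= rval rho
    & forall p q x y, nsq (rho p q * rho x y - rho x q * rho p y) <= harmonic i].
  by move=> i; exact: almost_pure.
(* A single ultrafilter makes all the bounded entries converge at once. *)
have [U [ultraU ooU]] := @ultraFilterLemma nat \oo%classic _.
have hU : (harmonic i @[i --> U] --> (0 : R))%classic.
  by apply: cvg_trans cvg_harmonic; move=> A; exact: ooU.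
have /choice[l lP] : forall xy : D * D, exists z, ccvg U (fun i => r i xy.1 xy.2) z.
  move=> [x y] /=.
  have b i := let: And5 p t _ _ _ := rP i in oppsd_bound1 p t x y.
  have [a ha] := ultra_bounded_cvg (fun i => (b i).1).
  have [a' ha'] := ultra_bounded_cvg (fun i => (b i).2).
  by exists (Complex a a').
pose rho x y := l (x, y).
have rl x y : ccvg U (fun i => r i x y) (rho x y) by exact: (lP (x, y)).
exists rho; split.
- by apply: (ccvg_oppsd rl) => i; have [] := rP i.
- have [h1 h2] : ccvg U (fun i => optr (r i)) (optr rho) by apply: ccvg_sum => x.
  have e1 : (fun i => optr (r i)) = fun=> 1 by apply/funext => i; have [] := rP i.
  have h3 : (cRe (optr (r i)) @[i --> U] --> (1 : R))%classic.
    by under eq_fun do rewrite (congr1 (@^~ _) e1); exact: cvg_cst.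
  have h4 : (cIm (optr (r i)) @[i --> U] --> (0 : R))%classic.
    by under eq_fun do rewrite (congr1 (@^~ _) e1); exact: cvg_cst.
  by apply: complex_ext; [exact: (cvg_unique _ h1 h3)|exact: (cvg_unique _ h2 h4)].
- apply: (ccvg_oppsd (A := fun i a b => Y a b - L (tr2 (r i)) a b)).
    move=> a b; apply: ccvgB; first exact: ccvg_cst.
    apply: ccvg_linear => x y; under eq_fun do rewrite mxE.
    by rewrite mxE; apply: ccvg_sum => j.
  by move=> i; have [] := rP i.
- have [h _] : ccvg U (fun i => xval X (r i)) (xval X rho).
    apply: ccvg_sum => x; apply: ccvg_sum => y.
    by apply: ccvgM (rl _ _); exact: ccvg_cst.
  have hc : (c - harmonic i @[i --> U] --> c - 0)%classic.
    by apply: cvgB => //; exact: cvg_cst.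
  rewrite subr0 in hc; apply: (ler_cvg_to hc h); apply: filterE => i.
  by have [] := rP i.
move=> p q x y; apply/eqP; rewrite -subr_eq0; apply/eqP.
set w := _ - _.
have [h1 h2] : ccvg U (fun i => r i p q * r i x y - r i x q * r i p y) w.
  by apply: ccvgB; exact: ccvgM.
have hn : (nsq (r i p q * r i x y - r i x q * r i p y) @[i --> U] --> nsq w)%classic.
  by apply: cvgD; rewrite expr2; exact: cvgM.
have : nsq w <= 0.
  by apply: (ler_cvg_to hn hU); apply: filterE => i; have [] := rP i.
rewrite /nsq => w0; have := sqr_ge0 (cRe w); have := sqr_ge0 (cIm w) => a1 a2.
apply: complex_ext => /=; apply/eqP; rewrite -sqrf_eq0; apply/eqP; lra.
Qed.

Lemma xi_val_ge : (c%:E <= xi_val k X L Y)%E.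
Proof.
have [rho [psd tr1 le ge r1]] := exact_pure.
have trE : \tr (tr2 rho) = 1.
  rewrite -tr1 /optr sum_pair; apply: eq_bigr => i _; by rewrite mxE.
apply: (@le_trans _ _ (rval rho)%:E); first by rewrite lee_fin.
apply: ereal_sup_ubound; exists (tr2 rho); split=> //.
- have : oppsd (fun i j => \sum_(l < k) rho (i, l) (j, l)).
    by apply: oppsd_sum => l; exact: (oppsd_pullback (fun i => (i, l)) psd).
  by apply: eq_oppsd => i j; rewrite mxE.
- have [p p0] : exists p, rho p p != 0.
    apply: contrapT => nex; have := oner_neq0 C; rewrite -tr1 /optr big1 ?eqxx // => p _.
    by apply/eqP/negPn/negP => p0; apply: nex; exists p.
  (* By the rank-one identity, [rho x y = rho x p * rho p y / rho p p], so [tr2 rho] factors through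
     [C^k] and has rank at most [k]. *)
  have -> : tr2 rho = (\matrix_(i < n, l < k) (rho (i, l) p / rho p p)) *m
       \matrix_(l < k, j < n) rho p (j, l).
    apply/matrixP => i j; rewrite !mxE; apply: eq_bigr => l _.
    by rewrite !mxE mulrAC (r1 (i, l) p p (j, l)) mulrC mulKf.
  exact: mulmx_max_rank.
by rewrite xval_tr2.
Qed.

End DeFinetti.

(** * Lower bound, monotonicity and infimum of the hierarchy *)

Section Bounds.
Variable R : realType.
Local Notation C := (R[i]).
Variables n m k : nat.
Variables (X : 'M[C]_n) (L : {linear 'M[C]_n -> 'M[C]_m}) (Y : 'M[C]_m).
Local Notation D := ('I_n * 'I_k)%type.
Local Notation op N := ({ffun 'I_N -> D} -> {ffun 'I_N -> D} -> C).
Local Open Scope ereal_scope.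

Lemma sdp_val_ge N (Phi : op N.+1) : cone L Y Phi -> optr Phi = 1%R ->
  (complex.Re (xval X (marg Phi)))%:E <= sdp_val k X L Y N.
Proof.
move=> [psd inv le] tr1; apply: ereal_sup_ubound; exists Phi; split=> //.
  exact/perm_inv_symproj.
by rewrite xval_marg.
Qed.

Lemma sdp_val_gt N (c : \bar R) : c < sdp_val k X L Y N ->
  exists Phi : op N.+1, [/\ cone L Y Phi, optr Phi = 1%R
    & c < (complex.Re (xval X (marg Phi)))%:E].
Proof.
move=> /ereal_sup_gt[y [Phi [psd tr1 inv le ->]]]; rewrite xval_marg => lt.
by exists Phi; split=> //; split=> //; exact/perm_inv_symproj.
Qed.

Lemma xi_val_le_sdp N : xi_val k X L Y <= sdp_val k X L Y N.
Proof.
apply: ge_ereal_sup => _ [rho [le tr1 psd rk ->]].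
have [B BE] := psdmx_factor psd rk.
(* The [k] columns of the factor are the components of a purification in [C^n (x) C^k]. *)
pose psi (x : D) := B x.1 x.2.
have rhoE : tr2 (pure psi) = rho.
  by apply/matrixP => i j; rewrite mxE BE.
have psi1 : optr (pure psi) = 1%R.
  rewrite -tr1 -rhoE /optr sum_pair; apply: eq_bigr => i _; by rewrite mxE.
have cPhi : cone L Y (@prodop R n k psi N.+1).
  by apply: cone_prodop => //; rewrite rhoE.
have := sdp_val_ge cPhi (optr_prodop psi1 N.+1); congr (_%:E <= _).
rewrite -rhoE xval_tr2; congr (complex.Re _).
by apply: eq_bigr => x _; apply: eq_bigr => y _; rewrite marg_prodop.
Qed.

(** Tracing out one party keeps feasibility and, by symmetry, the one-party marginal, on which alone
    the objective depends. *)
Lemma sdp_val_nonincreasing N : sdp_val k X L Y N.+1 <= sdp_val k X L Y N.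
Proof.
apply: ge_ereal_sup => _ [Phi [psd tr1 /perm_inv_symproj inv le ->]].
have margE : marg (ptrace Phi) = marg Phi.
  by apply/funext => x; apply/funext => y; exact: marg_ptrace.
rewrite xval_marg -margE; apply: sdp_val_ge; first exact: cone_ptrace.
by rewrite optrE margE -optrE.
Qed.

Lemma ereal_between (x y : \bar R) : x < y -> exists r : R, x < r%:E < y.
Proof.
case: x y => [x| |] [y| |] //=; rewrite ?ltxx //.
- rewrite lte_fin => xy; exists ((x + y) / 2)%R.
  by rewrite !lte_fin; apply/andP; split; lra.
- by move=> _; exists (x + 1)%R; rewrite lte_fin ltrDl ltr01 ltry.
- by move=> _; exists (y - 1)%R; rewrite lte_fin gtrDl oppr_lt0 ltr01 ltNyr.
- by move=> _; exists 0%R; rewrite ltNyr ltry.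
Qed.

(** A real [c] strictly between the two values would be exceeded by a feasible state at every level,
    and [xi_val_ge] would then give [c <= xi]. Choosing [c] real also covers infinite values. *)
Lemma sdp_val_inf : ereal_inf (range (sdp_val k X L Y)) = xi_val k X L Y.
Proof.
apply/eqP; rewrite eq_le; apply/andP; split; last first.
  by apply: le_ereal_inf_tmp => _ [N _ <-]; exact: xi_val_le_sdp.
rewrite leNgt; apply/negP => /ereal_between[c /andP[lt1 lt2]].
have : c%:E <= xi_val k X L Y.
  apply: xi_val_ge => N.
  have /sdp_val_gt[Phi [cPhi tr1]] : c%:E < sdp_val k X L Y N.
    by apply: lt_le_trans lt2 _; apply: ereal_inf_lbound; exists N.
  by rewrite lte_fin => lt; exists Phi; split=> //; exact: ltW.
by rewrite leNgt lt1.
Qed.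

End Bounds.

Unset Implicit Arguments.

Local Open Scope classical_set_scope.
Local Open Scope ereal_scope.

Theorem theorem5 (R : realType) (n m k : nat)
  (hn : (0 < n)%N) (hm : (0 < m)%N) (hk : (0 < k)%N)
  (X : 'M[R[i]]_n) (L : {linear 'M[R[i]]_n -> 'M[R[i]]_m}) (Y : 'M[R[i]]_m) :
  hermmx X -> herm_preserving L -> hermmx Y ->
  [/\ (forall N : nat, (0 < N)%N -> xi_val k X L Y <= xiN k X L Y N),
      (forall N : nat, (0 < N)%N -> xiN k X L Y N.+1 <= xiN k X L Y N)
    & xiN k X L Y N @[N --> \oo] --> xi_val k X L Y].
Proof.
move=> _ _ _; split=> [N _|[//|N] _|].
- exact: xi_val_le_sdp.
- exact: sdp_val_nonincreasing.
rewrite -sdp_val_inf.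
(* The shift aligns [xiN] at [N.+1] with [sdp_val] at [N], and drops the default value of [xiN] at
   0. *)
rewrite -cvg_shiftS.
apply: ereal_nonincreasing_cvgn; apply/nonincreasing_seqP => N.
exact: sdp_val_nonincreasing.
Qed.
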